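(* Let $\mathcal{I}=\left((\mathrm{E}_n)_{n\in\mathbb{N}},(p_{m,n})_{m\ge n}\right)$ be an inverse system in $\mathbf{NIVL}$, and let $\mathcal{S}=\left(\mathrm{E},(p_n)_{n\in\mathbb{N}}\right)$ be the inverse limit of $\mathcal{I}$ in $\mathbf{VL}$. Assume that $p_n$ is order continuous and $\mathrm{E}_n$ is Archimedean for each $n\in\mathbb{N}$, and that $p_{m,n}$ is a surjection for all $m\ge n$ in $\mathbb{N}$. Let $\mathcal{I}^\sim_{\mathrm n}=\left(((\mathrm{E}_n)^\sim_{\mathrm n})_{n\in\mathbb{N}},(p_{m,n}^\sim)_{m\ge n}\right)$ be the order continuous dual system. The following statements are true. (i) The direct limit $\varinjlim\mathcal{I}^\sim_{\mathrm n}=\left(\mathrm{G},(e_n)_{n\in\mathbb{N}}\right)$ exists in $\mathbf{NIVL}$. (ii) $(\varprojlim\mathcal{I})^\sim_{\mathrm n}\cong\varinjlim\mathcal{I}^\sim_{\mathrm n}$ in $\mathbf{NIVL}$; that is, there exists a lattice isomorphism $S:\mathrm{G}\to\mathrm{E}^\sim_{\mathrm n}$ such that $S\circ e_n=p_n^\sim$ (as maps $(\mathrm{E}_n)^\sim_{\mathrm n}\to\mathrm{E}^\sim_{\mathrm n}$) for all $n\in\mathbb{N}$.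
   Context: All vector lattices are real. A linear map between vector lattices is a lattice homomorphism if it preserves finite suprema and infima; it is normal if it is moreover order continuous. A positive $T:\mathrm{E}\to\mathrm{F}$ is interval preserving if $T[[0,u]]=[0,T(u)]$ for all $0\le u\in\mathrm{E}$. The categories $\mathbf{VL}$, $\mathbf{NIVL}$ have vector lattices as objects; morphisms are, respectively, lattice homomorphisms and normal interval preserving lattice homomorphisms. $\mathrm{E}^\sim$ is the vector lattice of order bounded linear functionals on $\mathrm{E}$ and $\mathrm{E}^\sim_{\mathrm n}$ is the sublattice of order continuous functionals; for a positive operator $T:\mathrm{E}\to\mathrm{F}$, $T^\sim$ is $\varphi\mapsto\varphi\circ T$ (it maps $\mathrm{F}^\sim_{\mathrm n}$ into $\mathrm{E}^\sim_{\mathrm n}$ if $T$ is order continuous). An inverse system in a category $\mathbf{C}$ (here over $\mathbb{N}$) consists of vector lattices $\mathrm{E}_n$ and $\mathbf{C}$-morphisms $p_{m,n}:\mathrm{E}_m\to\mathrm{E}_n$ ($m\ge n$) with $p_{m,n}\circ p_{k,m}=p_{k,n}$ for $n\le m\le k$; compatible systems $(\mathrm{E},(p_n:\mathrm{E}\to\mathrm{E}_n))$ of $\mathbf{C}$-morphisms satisfy $p_{m,n}\circ p_m=p_n$, and the inverse limit in $\mathbf{C}$ is a compatible system through which every compatible system $(\tilde{\mathrm{E}},(\tilde p_n))$ factors via a unique $\mathbf{C}$-morphism $s:\tilde{\mathrm{E}}\to\mathrm{E}$, $p_n\circ s=\tilde p_n$. In $\mathbf{VL}$ it always exists and is realised as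 $\{(u_n)\in\prod\mathrm{E}_n: p_{m,n}(u_m)=u_n \text{ for } m\ge n\}$ with $p_n$ the restricted coordinate projections. A direct system in $\mathbf{C}$ consists of vector lattices $\mathrm{G}_n$ and $\mathbf{C}$-morphisms $e_{n,m}:\mathrm{G}_n\to\mathrm{G}_m$ ($n\le m$) with $e_{m,k}\circ e_{n,m}=e_{n,k}$; compatible systems $(\mathrm{G},(e_n:\mathrm{G}_n\to\mathrm{G}))$ of $\mathbf{C}$-morphisms satisfy $e_m\circ e_{n,m}=e_n$, and the direct limit in $\mathbf{C}$ is a compatible system such that for each compatible system $(\tilde{\mathrm{G}},(\tilde e_n))$ there is a unique $\mathbf{C}$-morphism $r:\mathrm{G}\to\tilde{\mathrm{G}}$ with $r\circ e_n=\tilde e_n$ for all $n$. The order continuous dual system $\mathcal{I}^\sim_{\mathrm n}$, with maps $p_{m,n}^\sim:(\mathrm{E}_n)^\sim_{\mathrm n}\to(\mathrm{E}_m)^\sim_{\mathrm n}$, is a direct system in $\mathbf{NIVL}$. *)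

(* Defs.v *)
From HB Require Import structures.
From mathcomp Require Import all_boot all_order all_algebra.
From mathcomp Require Import mathcomp_extra boolp classical_sets functions reals.
From mathcomp Require Import ring lra.

Set Implicit Arguments.
Unset Strict Implicit.
Unset Printing Implicit Defensive.

Import Order.TTheory GRing.Theory Num.Theory.
Local Open Scope classical_set_scope.
Local Open Scope ring_scope.

(* Order structures and left modules have no common join in the hierarchy once
   Num.RealDomain is declared, so vector lattices are a plain record whose
   carrier then receives both an lmodType and a latticeType instance. *)
Record vectorLatticeType (R : realType) := VectorLattice {
  vl_base : lmodType R;
  vl_le : rel vl_base;
  vl_meet : vl_base -> vl_base -> vl_base;
  vl_join : vl_base -> vl_base -> vl_base;
  vl_le_refl : reflexive vl_le;
  vl_le_anti : antisymmetric vl_le;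
  vl_le_trans : transitive vl_le;
  vl_meetP : forall x y z, vl_le x (vl_meet y z) = vl_le x y && vl_le x z;
  vl_joinP : forall x y z, vl_le (vl_join x y) z = vl_le x z && vl_le y z;
  vl_leD : forall z x y, vl_le x y -> vl_le (x + z) (y + z);
  vl_leZ : forall (a : R) x, 0 <= a -> vl_le 0 x -> vl_le 0 (a *: x) }.

Definition vl_sort (R : realType) (E : vectorLatticeType R) : Type := vl_base E.
Coercion vl_sort : vectorLatticeType >-> Sortclass.

Section VectorLatticeInstances.
Variables (R : realType) (E : vectorLatticeType R).
HB.instance Definition _ := GRing.Lmodule.copy (vl_sort E) (vl_base E).
HB.instance Definition _ := Order.Le_isPOrder.Build ring_display (vl_sort E)
  (@vl_le_refl R E) (@vl_le_anti R E) (@vl_le_trans R E).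
HB.instance Definition _ :=
  Order.POrder_MeetJoin_isLattice.Build ring_display (vl_sort E)
    (@vl_meetP R E) (@vl_joinP R E).
End VectorLatticeInstances.

Section RealLine.
Variable R : realType.

Lemma real_leD (z x y : R^o) : x <= y -> x + z <= y + z.
Proof. by move=> xy; rewrite lerD2r. Qed.

Lemma real_leZ (a : R) (x : R^o) : 0 <= a -> 0 <= x -> 0 <= a *: x.
Proof. exact: mulr_ge0. Qed.

Definition real_line : vectorLatticeType R :=
  @VectorLattice R R^o <=%R Order.meet Order.join
    lexx le_anti le_trans lexI leUx real_leD real_leZ.

End RealLine.

Section VectorLatticeTheory.
Context {R : realType} {E : vectorLatticeType R}.
Implicit Types (x y z u v w : E).

Definition vabs x : E := (x `|` - x)%O.
Definition vpos x : E := (x `|` 0)%O.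

Lemma vlerD z x y : x <= y -> x + z <= y + z. Proof. exact: vl_leD. Qed.

Lemma vlerZ (a : R) x : 0 <= a -> 0 <= x -> 0 <= a *: x.
Proof. exact: vl_leZ. Qed.

Lemma vlerD2r z x y : (x + z <= y + z) = (x <= y).
Proof.
apply/idP/idP; last exact: vlerD.
by move=> /(vlerD (- z)); rewrite !addrK.
Qed.

Lemma vlerD2l z x y : (z + x <= z + y) = (x <= y).
Proof. by rewrite ![z + _]addrC vlerD2r. Qed.

Lemma vsubr_ge0 x y : (0 <= y - x) = (x <= y).
Proof. by rewrite -(vlerD2r x 0) add0r subrK. Qed.

Lemma vlerBlDr x y z : (x - y <= z) = (x <= z + y).
Proof. by rewrite -(vlerD2r y (x - y)) subrK. Qed.

Lemma vlerBrDr x y z : (x <= y - z) = (x + z <= y).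
Proof. by rewrite -(vlerD2r z x) subrK. Qed.

Lemma vlerN2 x y : (- x <= - y) = (y <= x).
Proof. by rewrite -(vsubr_ge0 (- x)) opprK addrC vsubr_ge0. Qed.

Lemma vaddr_ge0 x y : 0 <= x -> 0 <= y -> 0 <= x + y.
Proof. by move=> x0 y0; apply: le_trans x0 _; rewrite -{1}(addr0 x) vlerD2l. Qed.

Lemma vlerD2 x y z w : x <= y -> z <= w -> x + z <= y + w.
Proof.
move=> xy zw; apply: (@le_trans _ _ (y + z)); first by rewrite vlerD2r.
by rewrite vlerD2l.
Qed.

Lemma vlerZ2 (a : R) x y : 0 <= a -> x <= y -> a *: x <= a *: y.
Proof. by move=> a0 xy; rewrite -vsubr_ge0 -scalerBr vlerZ// vsubr_ge0. Qed.

Lemma vposB x : vpos x - vpos (- x) = x.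
Proof.
have le1 y : vpos y - y <= vpos (- y).
  rewrite vlerBlDr leUx -{1}[y]add0r vlerD2r leUr /=.
  by rewrite -(vlerD2r (- y)) addrK add0r leUl.
apply/eqP; rewrite eq_le vlerBlDr; apply/andP; split.
  by have := le1 x; rewrite vlerBlDr addrC.
by rewrite vlerBrDr; have := le1 (- x); rewrite opprK addrC.
Qed.

Lemma vpos_ge0 x : 0 <= vpos x. Proof. exact: leUr. Qed.

Lemma vpos_id x : 0 <= x -> vpos x = x.
Proof. by move=> x0; apply/eqP; rewrite eq_le leUx lexx x0 leUl. Qed.

Lemma vposN_id x : 0 <= x -> vpos (- x) = 0.
Proof.
move=> x0; apply/eqP; rewrite eq_le leUx lexx leUr andbT.
by rewrite -[0]oppr0 vlerN2 x0.
Qed.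

Lemma vpos0 : vpos (0 : E) = 0. Proof. by rewrite vpos_id. Qed.

Lemma vposZ (a : R) x : 0 <= a -> vpos (a *: x) = a *: vpos x.
Proof.
rewrite le_eqVlt => /orP[/eqP <-|a0]; first by rewrite !scale0r vpos0.
apply/eqP; rewrite eq_le; apply/andP; split.
  by rewrite leUx vlerZ2 ?leUl ?(ltW a0)//= vlerZ ?(ltW a0) ?vpos_ge0.
have -> : vpos (a *: x) = a *: (a^-1 *: vpos (a *: x)).
  by rewrite scalerA divff ?gt_eqF// scale1r.
apply: vlerZ2; first exact: ltW.
rewrite leUx vlerZ ?vpos_ge0 ?invr_ge0 ?(ltW a0)// andbT.
have xE : x = a^-1 *: (a *: x) by rewrite scalerA mulVf ?gt_eqF// scale1r.
by rewrite {1}xE vlerZ2 ?invr_ge0 ?(ltW a0)// leUl.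
Qed.

Lemma vabs_ge0_id x : 0 <= x -> vabs x = x.
Proof.
move=> x0; apply/eqP; rewrite eq_le leUx lexx leUl andbT /=.
by apply: (le_trans _ x0); rewrite -[0]oppr0 vlerN2.
Qed.

Lemma riesz_decomposition u v w : 0 <= v -> 0 <= w -> 0 <= u <= v + w ->
  exists u1 u2, [/\ u = u1 + u2, 0 <= u1 <= v & 0 <= u2 <= w].
Proof.
move=> v0 w0 /andP[u0 uvw].
exists (u `&` v)%O, (u - (u `&` v)%O); split.
- by rewrite addrC subrK.
- by rewrite lexI u0 v0 leIr.
- rewrite vsubr_ge0 leIl vlerBlDr addrC -vlerBlDr lexI.
  by rewrite -{2}[u]subr0 vlerD2l vlerN2 w0 vlerBlDr uvw.
Qed.

(* D is directed downwards with infimum 0, i.e. D (as a net) decreases to 0. *)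
Definition decreases_to0 (D : set E) :=
  [/\ D !=set0,
      forall x y, D x -> D y -> exists z, [/\ D z, z <= x & z <= y]
    & infimums D 0].

Definition archimedean :=
  forall u, 0 <= u -> infimums [set n.+1%:R^-1 *: u | n in [set: nat]] 0.

End VectorLatticeTheory.
Arguments archimedean {R} E.

Section Operators.
Context {R : realType} {E F : vectorLatticeType R}.
Implicit Types T : E -> F.

Definition positive_operator T := linear T /\ forall u, 0 <= u -> 0 <= T u.

Definition lattice_hom T :=
  [/\ linear T, {morph T : x y / (x `|` y)%O} & {morph T : x y / (x `&` y)%O}].

Definition order_bounded T :=
  forall a b, exists c d, forall x, a <= x <= b -> c <= T x <= d.

(* inf |T[D]| = 0 whenever D decreases to 0.  For positive T this says that T[D]
   decreases to 0; for order bounded functionals it is equivalent to the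
   preservation of order convergence of nets. *)
Definition order_continuous T :=
  forall D : set E, decreases_to0 D -> infimums [set vabs (T u) | u in D] 0.

Definition interval_preserving T := positive_operator T /\
  forall u, 0 <= u ->
    T @` [set v | 0 <= v <= u] = [set w | 0 <= w <= T u].

Definition normal_hom T := lattice_hom T /\ order_continuous T.

End Operators.

(* The Riesz-Kantorovich formula for the positive part of an order bounded
   functional. *)
Section RieszKantorovich.
Context {R : realType} {E : vectorLatticeType R}.
Variable f : E -> R.
Hypotheses (flin : linear (f : E -> R^o)).
Hypotheses (fbnd : @order_bounded R E (real_line R) f).
Implicit Types (x y u v : E) (a : R).

Let fD x y : f (x + y) = f x + f y.
Proof. by have := flin 1 x y; rewrite !scale1r. Qed.

Let f0 : f 0 = 0.
Proof. by apply: (@addrI _ (f 0)); rewrite -fD !addr0. Qed.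

Let fZ a x : f (a *: x) = a * f x.
Proof. by have := flin a x 0; rewrite f0 !addr0. Qed.

Definition segment_image u : set R := f @` [set v | 0 <= v <= u].

Definition rk_cone u : R := sup (segment_image u).

Let has_sup_segment_image u : 0 <= u -> has_sup (segment_image u).
Proof.
move=> u0; split; first by exists (f 0), 0 => //=; rewrite lexx u0.
have [c [d cd]] := fbnd 0 u.
by exists d => _ [v /= v0u <-]; have /andP[] := cd _ v0u.
Qed.

Let rk_cone_ge u v : 0 <= v <= u -> f v <= rk_cone u :> R.
Proof.
move=> v0u; apply: sup_upper_bound; last by exists v.
by apply: has_sup_segment_image; case/andP: v0u => /le_trans; apply.
Qed.

Let rk_cone_le u (M : R) : 0 <= u ->
  (forall v, 0 <= v <= u -> f v <= M :> R) -> rk_cone u <= M.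
Proof.
move=> u0 fM; apply: ge_sup; first by case: (has_sup_segment_image u0).
by move=> _ [v /= + <-]; apply: fM.
Qed.

Let rk_cone_ge0 u : 0 <= u -> 0 <= rk_cone u.
Proof. by move=> u0; rewrite -[leLHS]f0 rk_cone_ge// lexx. Qed.

Let rk_coneD u v : 0 <= u -> 0 <= v -> rk_cone (u + v) = rk_cone u + rk_cone v.
Proof.
move=> u0 v0.
rewrite -(sup_sumE (has_sup_segment_image u0) (has_sup_segment_image v0)).
congr sup; apply/seteqP; split=> [_ [w /= w0uv <-]|_ [_ [x xu <-] [_ [y yv <-] <-]]].
  have [w1 [w2 [-> w1u w2v]]] := riesz_decomposition u0 v0 w0uv.
  by exists (f w1); [exists w1|exists (f w2); [exists w2|rewrite fD]].
exists (x + y); last by rewrite fD.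
by case/andP: xu => x0 xu; case/andP: yv => y0 yv; rewrite /= vaddr_ge0 ?vlerD2.
Qed.

Let rk_coneZ_le a u : 0 < a -> 0 <= u -> a * rk_cone u <= rk_cone (a *: u).
Proof.
move=> a0 u0; rewrite -ler_pdivlMl//; apply: rk_cone_le => // v /andP[v0 vu].
rewrite ler_pdivlMl// -fZ.
by rewrite rk_cone_ge// vlerZ ?(ltW a0)// vlerZ2 ?(ltW a0).
Qed.

Let rk_coneZ a u : 0 <= a -> 0 <= u -> rk_cone (a *: u) = a * rk_cone u.
Proof.
rewrite le_eqVlt => /orP[/eqP <- _|a0 u0].
  rewrite scale0r mul0r; apply/eqP; rewrite eq_le rk_cone_ge0// andbT.
  apply: rk_cone_le => // v /andP[v0 v0'].
  by rewrite (@le_anti _ _ v 0) ?v0 ?v0'// f0.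
apply/eqP; rewrite eq_le rk_coneZ_le// andbT -ler_pdivrMl//.
have /le_trans -> // : a^-1 * rk_cone (a *: u) <= rk_cone (a^-1 *: (a *: u)).
  by rewrite rk_coneZ_le ?invr_gt0// vlerZ// ltW.
by rewrite scalerA mulVf ?gt_eqF// scale1r.
Qed.

Definition riesz_kantorovich (x : E) : R :=
  rk_cone (vpos x) - rk_cone (vpos (- x)).

Let rkE u v : 0 <= u -> 0 <= v ->
  riesz_kantorovich (u - v) = rk_cone u - rk_cone v.
Proof.
move=> u0 v0; apply/eqP; rewrite subr_eq addrAC eq_sym subr_eq; apply/eqP.
have posE : vpos (u - v) = u - v + vpos (- (u - v)).
  by apply/eqP; rewrite -subr_eq vposB.
rewrite -!rk_coneD ?vpos_ge0//; congr rk_cone.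
by rewrite posE addrAC subrK.
Qed.

Lemma riesz_kantorovichE u : 0 <= u ->
  riesz_kantorovich u = sup (f @` [set v | 0 <= v <= u]).
Proof.
move=> u0; have := rkE u0 (lexx 0); rewrite subr0 => ->.
suff -> : rk_cone 0 = 0 by rewrite subr0.
by rewrite -(scale0r (0 : E)) rk_coneZ// mul0r.
Qed.

Lemma riesz_kantorovich_ge0 u : 0 <= u -> 0 <= riesz_kantorovich u.
Proof. by move=> u0; rewrite riesz_kantorovichE// rk_cone_ge0. Qed.

Lemma riesz_kantorovich_ge u v : 0 <= v <= u -> f v <= riesz_kantorovich u :> R.
Proof.
move=> vu; rewrite riesz_kantorovichE ?rk_cone_ge//.
by case/andP: vu => /le_trans; apply.
Qed.

Lemma riesz_kantorovich_le u (M : R) : 0 <= u ->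
  (forall v, 0 <= v <= u -> f v <= M :> R) -> riesz_kantorovich u <= M.
Proof. by move=> u0 fM; rewrite riesz_kantorovichE//; apply: rk_cone_le. Qed.

Lemma riesz_kantorovich_linear : linear (riesz_kantorovich : E -> R^o).
Proof.
have rkD x y : riesz_kantorovich (x + y) = riesz_kantorovich x + riesz_kantorovich y.
  rewrite -{1}[x]vposB -{1}[y]vposB addrACA -opprD.
  by rewrite rkE ?vaddr_ge0 ?vpos_ge0// !rk_coneD ?vpos_ge0// opprD addrACA.
have rkN x : riesz_kantorovich (- x) = - riesz_kantorovich x.
  by rewrite /riesz_kantorovich opprK opprB.
have rkZ a x : 0 <= a -> riesz_kantorovich (a *: x) = a * riesz_kantorovich x.
  move=> a0; rewrite -{1}[x]vposB scalerBr rkE ?vlerZ ?vpos_ge0//.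
  by rewrite !rk_coneZ ?vpos_ge0// mulrBr.
move=> a x y; rewrite rkD; congr +%R.
have [a0|a0] := leP 0 a; first exact: rkZ.
rewrite -[a]opprK scaleNr rkN rkZ ?oppr_ge0 ?(ltW a0)//.
by rewrite scaleNr.
Qed.

End RieszKantorovich.

Section OrderDual.
Context {R : realType} {E : vectorLatticeType R}.
Implicit Types (f g : E -> R^o) (u v x : E).

Definition order_dual_pred : {pred E -> R^o} :=
  fun f => `[< linear f /\ @order_bounded R E (real_line R) f >].

Lemma order_boundedP f : @order_bounded R E (real_line R) f <->
  forall a b, exists M : R, forall x, a <= x <= b -> `|f x| <= M.
Proof.
split=> [fb a b|fb a b].
  have [c [d cd]] := fb a b; exists (`|c : R| + `|d : R|) => x /cd /andP[cf fd].
  have cf' : (c : R) <= f x := cf; have fd' : f x <= (d : R) := fd.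
  have := ler_norm (d : R); have := ler_norm (- (c : R)); rewrite normrN.
  have := normr_ge0 (c : R); have := normr_ge0 (d : R); rewrite ler_norml.
  by move=> ? ? ? ?; apply/andP; split; lra.
have [M fM] := fb a b; exists (- M : R), (M : R) => x /fM.
by rewrite ler_norml.
Qed.

Lemma order_dual_submod : submod_closed order_dual_pred.
Proof.
split=> [|a f g /asboolP[fl fb] /asboolP[gl gb]]; apply/asboolP; split.
- by move=> a x y /=; rewrite scaler0 addr0.
- by apply/order_boundedP => a b; exists 0 => x _; rewrite normr0.
- move=> b x y /=; rewrite !fctE fl gl /=.
  by rewrite /GRing.scale/=; ring.
- apply/order_boundedP => c d.
  have /order_boundedP/(_ c d)[M fM] := fb.
  have /order_boundedP/(_ c d)[N gN] := gb.
  exists (`|a| * M + N) => x cxd.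
  apply: (le_trans (ler_normD _ _)); rewrite lerD ?gN// normrM.
  by rewrite ler_wpM2l ?fM.
Qed.

HB.instance Definition _ :=
  GRing.isSubmodClosed.Build R (E -> R^o) order_dual_pred order_dual_submod.

End OrderDual.

Section OrderDualLattice.
Variables (R : realType) (E : vectorLatticeType R).

Record order_dual_fun := OrderDualFun {
  order_dual_val :> E -> R^o;
  order_dual_valP : order_dual_val \in order_dual_pred }.

HB.instance Definition _ := [isSub for order_dual_val].
HB.instance Definition _ := [Choice of order_dual_fun by <:].
HB.instance Definition _ := [SubChoice_isSubLmodule of order_dual_fun by <:].

Implicit Types (f g h : order_dual_fun) (u v x : E).

Lemma order_dual_linear f : linear f.
Proof. by have /asboolP[] := order_dual_valP f. Qed.

Lemma order_dual_bounded f : @order_bounded R E (real_line R) f.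
Proof. by have /asboolP[] := order_dual_valP f. Qed.

Lemma order_dualD f x y : f (x + y) = f x + f y.
Proof. by have := order_dual_linear f 1 x y; rewrite !scale1r. Qed.

Lemma order_dualN f x : f (- x) = - f x.
Proof.
have f0 : f 0 = 0 by apply: (@addrI _ (f 0)); rewrite -order_dualD !addr0.
by apply/eqP; rewrite -subr_eq0 opprK -order_dualD addNr f0.
Qed.

Lemma order_dualB f x y : f (x - y) = f x - f y.
Proof. by rewrite order_dualD order_dualN. Qed.

Lemma order_dual_addE f g x : (f + g) x = f x + g x. Proof. by []. Qed.
Lemma order_dual_oppE f x : (- f) x = - f x. Proof. by []. Qed.
Lemma order_dual_scaleE (a : R) f x : (a *: f) x = a * f x. Proof. by []. Qed.
Lemma order_dual_zeroE x : (0 : order_dual_fun) x = 0. Proof. by []. Qed.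

Lemma order_dual_eq f g : (forall u, 0 <= u -> f u = g u) -> f = g.
Proof.
move=> fg; apply/val_inj/funext => x; change (f x = g x).
by rewrite -[x]vposB !order_dualB !fg ?vpos_ge0.
Qed.

(* The order of the order dual is pointwise on the positive cone of E. *)
Definition order_dual_le : rel order_dual_fun :=
  fun f g => `[< forall u, 0 <= u -> f u <= g u >].

Lemma order_dual_le_refl : reflexive order_dual_le.
Proof. by move=> f; apply/asboolP. Qed.

Lemma order_dual_le_anti : antisymmetric order_dual_le.
Proof.
move=> f g /andP[/asboolP fg /asboolP gf]; apply: order_dual_eq => u u0.
by apply/eqP; rewrite eq_le fg// gf.
Qed.

Lemma order_dual_le_trans : transitive order_dual_le.
Proof.
move=> g f h /asboolP fg /asboolP gh; apply/asboolP => u u0.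
exact: le_trans (fg _ u0) (gh _ u0).
Qed.

Lemma order_dual_leD h f g : order_dual_le f g -> order_dual_le (f + h) (g + h).
Proof. by move=> /asboolP fg; apply/asboolP => u u0; rewrite lerD2r fg. Qed.

Lemma order_dual_leZ (a : R) f : 0 <= a -> order_dual_le 0 f -> order_dual_le 0 (a *: f).
Proof.
by move=> a0 /asboolP f0; apply/asboolP => u u0; rewrite mulr_ge0// f0.
Qed.

Lemma riesz_kantorovich_dual f :
  (riesz_kantorovich f : E -> R^o) \in order_dual_pred.
Proof.
have rkl := riesz_kantorovich_linear (order_dual_linear f) (order_dual_bounded f).
apply/asboolP; split=> // a b; exists (riesz_kantorovich f a), (riesz_kantorovich f b).
have rkB x y : riesz_kantorovich f (x - y) = riesz_kantorovich f x - riesz_kantorovich f y.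
  by rewrite [x - y]addrC -scaleN1r rkl addrC; congr +%R; apply: mulN1r.
have mono x y : x <= y -> riesz_kantorovich f x <= riesz_kantorovich f y.
  move=> xy; rewrite -subr_ge0 -rkB riesz_kantorovich_ge0 ?vsubr_ge0//.
    exact: order_dual_linear.
  exact: order_dual_bounded.
by move=> x /andP[ax xb]; apply/andP; split; apply: mono.
Qed.

Definition order_dual_pos f : order_dual_fun :=
  OrderDualFun (riesz_kantorovich_dual f).

Lemma order_dual_posP f g :
  order_dual_le (order_dual_pos f) g = order_dual_le f g && order_dual_le 0 g.
Proof.
have fl := order_dual_linear f; have fb := order_dual_bounded f.
apply/asboolP/andP => [h|[/asboolP fg /asboolP g0] u u0].
  split; apply/asboolP => u u0; apply: le_trans (h u u0).
    by apply: riesz_kantorovich_ge => //; rewrite u0 lexx.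
  exact: riesz_kantorovich_ge0.
apply: riesz_kantorovich_le => // v /andP[v0 vu].
apply: le_trans (fg v v0) _.
by rewrite -subr_ge0 -order_dualB g0// vsubr_ge0.
Qed.

Definition order_dual_join f g := order_dual_pos (f - g) + g.
Definition order_dual_meet f g := - order_dual_join (- f) (- g).

Let leDr h f g : order_dual_le (f + h) (g + h) = order_dual_le f g.
Proof. by apply/idP/idP => [/(order_dual_leD (- h))|/order_dual_leD]; rewrite ?addrK. Qed.

Let leN f g : order_dual_le (- f) (- g) = order_dual_le g f.
Proof. by rewrite -(leDr (f + g)) addKr addrCA addNr addr0. Qed.

Lemma order_dual_joinP f g h : order_dual_le (order_dual_join f g) h =
  order_dual_le f h && order_dual_le g h.
Proof.
rewrite -(leDr (- g)) addrK order_dual_posP leDr; congr (_ && _).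
by rewrite -(leDr g) add0r subrK.
Qed.

Lemma order_dual_meetP f g h : order_dual_le f (order_dual_meet g h) =
  order_dual_le f g && order_dual_le f h.
Proof. by rewrite -leN opprK order_dual_joinP !leN. Qed.

Definition order_dual : vectorLatticeType R :=
  @VectorLattice R order_dual_fun order_dual_le order_dual_meet order_dual_join
    order_dual_le_refl order_dual_le_anti order_dual_le_trans
    order_dual_meetP order_dual_joinP order_dual_leD order_dual_leZ.

End OrderDualLattice.

Section OrderContinuousDual.
Variables (R : realType) (E : vectorLatticeType R).
Implicit Types (f g h : order_dual_fun E) (u v x y d : E) (D : set E).

Let oc f := @order_continuous R E (real_line R) f.

Let vabs_real (r : R) : @vabs R (real_line R) r = `|r| :> R.
Proof.
apply/eqP; rewrite eq_le; apply/andP; split.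
  have : (@vabs R (real_line R) r <= (`|r| : real_line R)); last by [].
  by rewrite leUx; apply/andP; split; [exact: ler_norm|rewrite -normrN; exact: ler_norm].
rewrite ler_norml lerNl; apply/andP; split.
  exact: (@leUr _ (real_line R) (- r) r).
exact: (@leUl _ (real_line R) r (- r)).
Qed.

Lemma order_continuous_dualP f : oc f <-> forall D, decreases_to0 D ->
  forall eps : R, 0 < eps -> exists2 d, D d & `|f d| < eps.
Proof.
split=> [fc D D0 eps eps0|fc D D0].
  have [_ inf0] := fc D D0; apply: contrapT => noD.
  suff : (eps : R) <= 0 by rewrite leNgt eps0.
  apply: (inf0 eps) => _ [d /= Dd <-].
  have : eps <= `|f d| by rewrite leNgt; apply/negP => fd; apply: noD; exists d.
  by rewrite -vabs_real.
split=> [_ [d /= Dd <-]|c c0].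
  by have := normr_ge0 (f d); rewrite -vabs_real.
have : (c : R) <= 0; last by [].
rewrite leNgt; apply/negP => /(fc D D0)[d Dd]; rewrite ltNge => /negP; apply.
by rewrite -vabs_real; apply: c0; exists d.
Qed.

Let pos_ge0 f u : 0 <= u -> 0 <= order_dual_pos f u.
Proof.
by apply: riesz_kantorovich_ge0;
  [exact: order_dual_linear|exact: order_dual_bounded].
Qed.

Let pos_ge f u v : 0 <= v <= u -> f v <= order_dual_pos f u.
Proof.
by apply: riesz_kantorovich_ge;
  [exact: order_dual_linear|exact: order_dual_bounded].
Qed.

Let pos_mono f u v : u <= v -> order_dual_pos f u <= order_dual_pos f v.
Proof. by move=> uv; rewrite -subr_ge0 -order_dualB pos_ge0// vsubr_ge0. Qed.

Lemma decreases_ge0 D d : decreases_to0 D -> D d -> 0 <= d.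
Proof. by case=> _ _ [+ _] Dd; apply. Qed.

Let pos_small f : oc f -> forall D, decreases_to0 D ->
  forall eps : R, 0 < eps -> exists2 d, D d & order_dual_pos f d < eps.
Proof.
move=> /order_continuous_dualP fc D D0 eps eps0.
have [[x Dx] Ddir [Dge0 Dinf]] := D0.
have x0 := decreases_ge0 D0 Dx.
have e20 : 0 < eps / 2 by rewrite divr_gt0.
have [y /andP[y0 yx] fy] : exists2 y, 0 <= y <= x &
    order_dual_pos f x < f y + eps / 2.
  apply: contrapT => noy.
  suff : order_dual_pos f x <= order_dual_pos f x - eps / 2.
    by rewrite lerBrDr gerDl leNgt e20.
  apply: riesz_kantorovich_le => //.
  - exact: order_dual_linear.
  - exact: order_dual_bounded.
  move=> v v0x; rewrite lerBrDr leNgt; apply/negP => xv.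
  by apply: noy; exists v.
pose D' := [set (y `&` d)%O | d in [set d | D d /\ d <= x]].
have D'0 : decreases_to0 D'.
  split.
  - by exists (y `&` x)%O, x.
  - move=> _ _ [d1 [/= Dd1 d1x] <-] [d2 [/= Dd2 d2x] <-].
    have [d [Dd dd1 dd2]] := Ddir _ _ Dd1 Dd2.
    exists (y `&` d)%O; split.
    + by exists d => //; split=> //; exact: le_trans dd1 d1x.
    + exact: leI2.
    + exact: leI2.
  - split=> [_ [d [/= Dd dx] <-]|l lD'].
      by rewrite lexI y0 (decreases_ge0 D0 Dd).
    apply: Dinf => e De.
    have [d [Dd dd1 dd2]] := Ddir _ _ De Dx.
    apply: le_trans dd1; apply: (@le_trans _ _ (y `&` d)%O); last exact: leIr.
    by apply: lD'; exists d.
have [_ [d [/= Dd dx] <-] fd] := fc _ D'0 _ e20.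
exists d => //.
have d0 := decreases_ge0 D0 Dd.
have ydx : 0 <= y - (y `&` d)%O <= x - d.
  rewrite vsubr_ge0 leIl /= vlerBrDr addrAC vlerBlDr [x + _]addrC -vlerBlDr.
  rewrite lexI; apply/andP; split; first by rewrite vlerBlDr vlerD2l.
  by rewrite vlerBlDr addrC vlerD2l.
have := pos_ge f ydx; rewrite !order_dualB.
move=> fyd; have fd' := ler_norm (f (y `&` d)%O).
by change (order_dual_pos f d < eps); lra.
Qed.

Let oc_small f : oc f <-> forall D, decreases_to0 D -> forall eps : R, 0 < eps ->
  exists2 d, D d & forall e, D e -> e <= d -> `|f e| < eps.
Proof.
split=> [fc D D0 eps eps0|fs]; last first.
  apply/order_continuous_dualP => D D0 eps eps0; have [d Dd fd] := fs D D0 _ eps0.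
  by exists d => //; exact: fd.
have e20 : 0 < eps / 2 by rewrite divr_gt0.
have fNc : oc (- f).
  apply/order_continuous_dualP => D1 D10 eps1 eps10; have /order_continuous_dualP/(_ D1 D10 eps1 eps10)[d Dd fd] := fc.
  by exists d; rewrite // order_dual_oppE normrN.
have [d1 Dd1 fd1] := pos_small fc D0 e20.
have [d2 Dd2 fd2] := pos_small fNc D0 e20.
have [_ Ddir _] := D0; have [d [Dd dd1 dd2]] := Ddir _ _ Dd1 Dd2.
exists d => // e De ed; have e0 := decreases_ge0 D0 De.
have ee : 0 <= e <= e by rewrite e0 lexx.
have fe1 := pos_ge f ee.
have := pos_ge (- f) ee; rewrite order_dual_oppE => fe2.
have := pos_ge0 f e0; have := pos_ge0 (- f) e0.
have := pos_mono f (le_trans ed dd1); have := pos_mono (- f) (le_trans ed dd2).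
by rewrite ltr_norml => *; apply/andP; split; lra.
Qed.

Definition oc_dual_pred : {pred order_dual_fun E} :=
  fun f => `[< @order_continuous R E (real_line R) f >].

Lemma oc_dual_submod : submod_closed oc_dual_pred.
Proof.
split=> [|a f g /asboolP/oc_small fc /asboolP/oc_small gc]; apply/asboolP/oc_small.
  move=> D [[x Dx] _ _] eps eps0; exists x => // e _ _.
  by rewrite order_dual_zeroE normr0.
move=> D D0 eps eps0.
have ae : 0 < eps / 2 / (`|a| + 1) by rewrite !divr_gt0// ltr_wpDl.
have [d1 Dd1 fd1] := fc D D0 _ ae.
have e20 : 0 < eps / 2 by rewrite divr_gt0.
have [d2 Dd2 gd2] := gc D D0 _ e20.
have [_ Ddir _] := D0; have [d [Dd dd1 dd2]] := Ddir _ _ Dd1 Dd2.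
exists d => // e De ed.
rewrite order_dual_addE order_dual_scaleE.
apply: (le_lt_trans (ler_normD _ _)); rewrite [ltRHS]splitr normrM.
rewrite ltr_leD ?(ltW (gd2 _ De (le_trans ed dd2)))//.
have := fd1 _ De (le_trans ed dd1); rewrite ltr_pdivlMr ?ltr_wpDl// => fe.
by apply: le_lt_trans fe; rewrite mulrC ler_wpM2l// lerDl.
Qed.

HB.instance Definition _ := GRing.isSubmodClosed.Build R (order_dual_fun E)
  oc_dual_pred oc_dual_submod.

Lemma oc_dual_pos f : f \in oc_dual_pred -> order_dual_pos f \in oc_dual_pred.
Proof.
move=> /asboolP fc; apply/asboolP/order_continuous_dualP => D D0 eps eps0.
have [d Dd fd] := pos_small fc D0 eps0; exists d => //.
by rewrite ger0_norm// pos_ge0// (decreases_ge0 D0 Dd).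
Qed.

Record oc_dual_fun := OcDualFun {
  oc_dual_val :> order_dual_fun E;
  oc_dual_valP : oc_dual_val \in oc_dual_pred }.

HB.instance Definition _ := [isSub for oc_dual_val].
HB.instance Definition _ := [Choice of oc_dual_fun by <:].
HB.instance Definition _ := [SubChoice_isSubLmodule of oc_dual_fun by <:].

Lemma oc_dual_joinP (f g : oc_dual_fun) :
  vl_join (f : order_dual E) (g : order_dual E) \in oc_dual_pred.
Proof. by rewrite /= rpredD ?oc_dual_pos ?rpredB ?oc_dual_valP. Qed.

Lemma oc_dual_meetP (f g : oc_dual_fun) :
  vl_meet (f : order_dual E) (g : order_dual E) \in oc_dual_pred.
Proof. by rewrite /= rpredN rpredD ?oc_dual_pos ?rpredB ?rpredN ?oc_dual_valP. Qed.

Definition oc_dual_le : rel oc_dual_fun :=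
  fun f g : oc_dual_fun => vl_le (f : order_dual E) (g : order_dual E).

Lemma oc_dual_le_refl : reflexive oc_dual_le.
Proof. by move=> f; apply: (@vl_le_refl R (order_dual E)). Qed.

Lemma oc_dual_le_anti : antisymmetric oc_dual_le.
Proof. by move=> f g fg; apply/val_inj/(@vl_le_anti R (order_dual E)). Qed.

Lemma oc_dual_le_trans : transitive oc_dual_le.
Proof. by move=> f g h; apply: (@vl_le_trans R (order_dual E)). Qed.

Lemma oc_dual_leD (h f g : oc_dual_fun) : oc_dual_le f g -> oc_dual_le (f + h) (g + h).
Proof. exact: (@vl_leD R (order_dual E) (oc_dual_val h)). Qed.

Lemma oc_dual_leZ (a : R) (f : oc_dual_fun) : 0 <= a -> oc_dual_le 0 f -> oc_dual_le 0 (a *: f).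
Proof. exact: (@vl_leZ R (order_dual E) a (oc_dual_val f)). Qed.

Definition oc_dual : vectorLatticeType R :=
  @VectorLattice R oc_dual_fun oc_dual_le
    (fun f g : oc_dual_fun => OcDualFun (oc_dual_meetP f g))
    (fun f g : oc_dual_fun => OcDualFun (oc_dual_joinP f g))
    oc_dual_le_refl oc_dual_le_anti oc_dual_le_trans
    (fun f g h : oc_dual_fun => @vl_meetP R (order_dual E) f g h)
    (fun f g h : oc_dual_fun => @vl_joinP R (order_dual E) f g h) oc_dual_leD oc_dual_leZ.

End OrderContinuousDual.

Section Adjoint.
Context {R : realType} {E F : vectorLatticeType R}.
Implicit Types T : E -> F.

Lemma positive_operatorB T : positive_operator T -> {morph T : x y / x - y}.
Proof.
by move=> [Tl _] x y; rewrite [x - y]addrC -scaleN1r Tl scaleN1r addrC.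
Qed.

Lemma positive_operator_mono T : positive_operator T -> {homo T : x y / x <= y}.
Proof.
move=> Tp x y xy; rewrite -vsubr_ge0 -positive_operatorB//.
by apply: Tp.2; rewrite vsubr_ge0.
Qed.

Lemma lattice_hom_positive T : lattice_hom T -> positive_operator T.
Proof.
move=> [Tl Tj _]; split=> // u u0.
have T0 : T 0 = 0.
  by have := Tl 1 0 0; rewrite !scale1r addr0 -{1}[T 0]addr0 => /addrI <-.
by rewrite -(join_r u0) Tj T0 leUl.
Qed.

Lemma decreases_to0_image T D : positive_operator T -> order_continuous T ->
  decreases_to0 D -> decreases_to0 (T @` D).
Proof.
move=> Tp Tc D0; have [[x Dx] Ddir [Dge0 _]] := D0; split.
- by exists (T x), x.
- move=> _ _ [d1 Dd1 <-] [d2 Dd2 <-]; have [d [Dd dd1 dd2]] := Ddir _ _ Dd1 Dd2.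
  by exists (T d); split; [exists d|exact: positive_operator_mono..].
- have -> : T @` D = [set vabs (T u) | u in D]; last exact: Tc.
  by apply: eq_imagel => u Du; rewrite vabs_ge0_id// Tp.2// Dge0.
Qed.

Lemma adjoint_order_dual T (phi : order_dual_fun F) : positive_operator T ->
  (phi \o T : E -> R^o) \in order_dual_pred.
Proof.
move=> Tp; apply/asboolP; split=> [a x y /=|a b].
  by rewrite Tp.1; apply: order_dual_linear.
have [c [d cd]] := order_dual_bounded phi (T a) (T b).
exists c, d => x /andP[ax xb]; apply: cd.
by rewrite !positive_operator_mono.
Qed.

Lemma adjoint_oc_dual T (phi : oc_dual_fun F) (Tp : positive_operator T) :
  order_continuous T ->
  OrderDualFun (adjoint_order_dual phi Tp) \in oc_dual_pred (E := E).
Proof.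
move=> Tc; apply/asboolP/order_continuous_dualP => D D0 eps eps0.
have /asboolP/order_continuous_dualP phic := oc_dual_valP phi.
have [_ [d Dd <-] fd] := phic _ (decreases_to0_image Tp Tc D0) _ eps0.
by exists d.
Qed.

Definition oc_adjoint T (Tp : positive_operator T) (Tc : order_continuous T)
    (phi : oc_dual F) : oc_dual E :=
  OcDualFun (adjoint_oc_dual phi Tp Tc).

Definition lattice_iso T := lattice_hom T /\ bijective T.

End Adjoint.

Section Categories.
Variable R : realType.

Definition morphism_class :=
  forall E F : vectorLatticeType R, (E -> F) -> Prop.

Definition VL : morphism_class := fun E F T => lattice_hom T.

Definition NIVL : morphism_class :=
  fun E F T => normal_hom T /\ interval_preserving T.

Variable C : morphism_class.

Record inverse_diagram := InverseDiagram {
  inv_obj :> nat -> vectorLatticeType R;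
  inv_map : forall m n, (n <= m)%N -> inv_obj m -> inv_obj n }.

(* inv_map n n is only idempotent here; it is the identity as soon as it is
   surjective. *)
Definition is_inverse_system (I : inverse_diagram) :=
  (forall m n (nm : (n <= m)%N), C (@inv_map I m n nm)) /\
  (forall k m n (nm : (n <= m)%N) (mk : (m <= k)%N),
    @inv_map I m n nm \o @inv_map I k m mk =1 @inv_map I k n (leq_trans nm mk)).

Record inverse_cone (I : inverse_diagram) := InverseCone {
  cone_obj :> vectorLatticeType R;
  cone_map : forall n, cone_obj -> I n }.

Definition is_inverse_compatible (I : inverse_diagram) (S : inverse_cone I) :=
  (forall n, C (@cone_map I S n)) /\
  (forall m n (nm : (n <= m)%N),
    @inv_map I m n nm \o @cone_map I S m =1 @cone_map I S n).

Definition is_inverse_limit (I : inverse_diagram) (S : inverse_cone I) :=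
  [/\ is_inverse_system I, is_inverse_compatible S &
      forall S' : inverse_cone I, is_inverse_compatible S' ->
        exists! s : S' -> S,
          C s /\ forall n, @cone_map I S n \o s =1 @cone_map I S' n].

Record direct_diagram := DirectDiagram {
  dir_obj :> nat -> vectorLatticeType R;
  dir_map : forall n m, (n <= m)%N -> dir_obj n -> dir_obj m }.

Definition is_direct_system (D : direct_diagram) :=
  (forall n m (nm : (n <= m)%N), C (@dir_map D n m nm)) /\
  (forall n m k (nm : (n <= m)%N) (mk : (m <= k)%N),
    @dir_map D m k mk \o @dir_map D n m nm =1 @dir_map D n k (leq_trans nm mk)).

Record direct_cocone (D : direct_diagram) := DirectCocone {
  cocone_obj :> vectorLatticeType R;
  cocone_map : forall n, D n -> cocone_obj }.

Definition is_direct_compatible (D : direct_diagram) (G : direct_cocone D) :=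
  (forall n, C (@cocone_map D G n)) /\
  (forall n m (nm : (n <= m)%N),
    @cocone_map D G m \o @dir_map D n m nm =1 @cocone_map D G n).

Definition is_direct_limit (D : direct_diagram) (G : direct_cocone D) :=
  [/\ is_direct_system D, is_direct_compatible G &
      forall G' : direct_cocone D, is_direct_compatible G' ->
        exists! r : G -> G',
          C r /\ forall n, r \o @cocone_map D G n =1 @cocone_map D G' n].

End Categories.

Section OcDualSystem.
Context {R : realType} {I : inverse_diagram R}.
Hypothesis hI : is_inverse_system (@NIVL R) I.

Lemma inv_map_positive m n (nm : (n <= m)%N) :
  positive_operator (@inv_map R I m n nm).
Proof. by have [[/lattice_hom_positive]] := hI.1 m n nm. Qed.

Lemma inv_map_order_continuous m n (nm : (n <= m)%N) :
  order_continuous (@inv_map R I m n nm).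
Proof. by have [[]] := hI.1 m n nm. Qed.

Definition oc_dual_system : direct_diagram R :=
  @DirectDiagram R (fun n => oc_dual (I n)) (fun n m nm =>
    oc_adjoint (inv_map_positive nm) (inv_map_order_continuous nm)).

End OcDualSystem.

Lemma inverse_limit_positive (R : realType) (I : inverse_diagram R)
    (S : inverse_cone I) (hS : is_inverse_limit (@VL R) S) n :
  positive_operator (@cone_map R I S n).
Proof. by have [_ [/(_ n)/lattice_hom_positive]] := hS. Qed.

(* Main.v *)
(* E is the lattice of compatible families, so each p_n is surjective, and an
   order bounded functional on E vanishes on the kernel of some p_n: otherwise
   it would be unbounded on the order interval below a suitable infinite sum.
   Such a functional factors through p_n, and the factor is order continuous if
   the functional is, because E is Archimedean.  Hence the adjoints of the p_n (like those of the
   p_{m,n}) are order isomorphisms onto ideals of the order continuous dual of E,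
   and these ideals cover it.  An injective and jointly surjective cocone in NIVL
   is a direct limit, and direct limits are unique up to isomorphism. *)
Require Import Defs.
From HB Require Import structures.
From mathcomp Require Import all_boot all_order all_algebra.
From mathcomp Require Import boolp classical_sets functions reals.

Set Implicit Arguments.
Unset Strict Implicit.
Unset Printing Implicit Defensive.

Import Order.TTheory GRing.Theory Num.Theory.
Local Open Scope classical_set_scope.
Local Open Scope ring_scope.

(** * Linear maps and vector lattice identities *)

Section LinearMaps.
Context {R : realType} {E F : vectorLatticeType R}.
Variable T : E -> F.
Hypothesis Tl : linear T.

Lemma linear_add : {morph T : x y / x + y}.
Proof. by move=> x y; have := Tl 1 x y; rewrite !scale1r. Qed.

Lemma linear_zero : T 0 = 0.
Proof. by apply: (@addrI _ (T 0)); rewrite -linear_add !addr0. Qed.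

Lemma linear_opp : {morph T : x / - x}.
Proof. by move=> x; have := Tl (-1) x 0; rewrite !addr0 linear_zero addr0 !scaleN1r. Qed.

Lemma linear_sub : {morph T : x y / x - y}.
Proof. by move=> x y; rewrite linear_add linear_opp. Qed.

Lemma linear_scale (a : R) : {morph T : x / a *: x}.
Proof. by move=> x; have := Tl a x 0; rewrite linear_zero !addr0. Qed.

End LinearMaps.

Section LatticeIdentities.
Context {R : realType} {E : vectorLatticeType R}.
Implicit Types x y : E.

(** With [meet_join_opp], this reduces preservation of joins and meets by a linear map to
    preservation of positive parts. *)
Lemma join_vpos x y : (x `|` y)%O = vpos (x - y) + y.
Proof.
apply/eqP; rewrite eq_le; apply/andP; split.
  by rewrite leUx -vlerBlDr leUl -{1}[y]add0r vlerD2r vpos_ge0.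
by rewrite -vlerBrDr leUx vlerD2r leUl vsubr_ge0 leUr.
Qed.

Lemma meet_join_opp x y : (x `&` y)%O = - (- x `|` - y)%O.
Proof.
apply/eqP; rewrite eq_le; apply/andP; split.
  by rewrite -vlerN2 opprK leUx !vlerN2 leIl leIr.
by rewrite lexI -(vlerN2 x) -(vlerN2 y) opprK leUl leUr.
Qed.

Lemma archimedean_le0 x l : archimedean E -> 0 <= x ->
  (forall n, l *+ n.+1 <= x) -> l <= 0.
Proof.
move=> Earch x0 lx; apply: (Earch x x0).2 => _ [n _ <-].
have -> : l = n.+1%:R^-1 *: (l *+ n.+1).
  by rewrite -scaler_nat scalerA mulVf ?scale1r// pnatr_eq0.
by rewrite vlerZ2// invr_ge0 ler0n.
Qed.

End LatticeIdentities.

(** * Lattice homomorphisms and lifting along surjective ones *)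

Section LatticeHoms.
Context {R : realType} {E F : vectorLatticeType R}.
Variable T : E -> F.
Hypothesis Th : lattice_hom T.

Let Tl : linear T. Proof. by case: Th. Qed.

Lemma lattice_hom_mono : {homo T : x y / x <= y}.
Proof. exact/positive_operator_mono/lattice_hom_positive. Qed.

Lemma lattice_hom_vpos x : T (vpos x) = vpos (T x).
Proof. by case: Th => _ TU _; rewrite /vpos TU (linear_zero Tl). Qed.

Lemma lattice_hom_inj_le : injective T -> {mono T : x y / x <= y}.
Proof.
move=> Tinj x y; apply/idP/idP => [Txy|]; last exact: lattice_hom_mono.
by apply/meet_idPl/Tinj; have [_ _ ->] := Th; apply/meet_idPl.
Qed.

Hypothesis Tsurj : range T = setT.

Lemma surjective_lift y : exists x, T x = y.
Proof.
have [x _ <-] : range T y by rewrite Tsurj.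
by exists x.
Qed.

Lemma surjective_lift_segment u v y : T u <= y <= T v -> u <= v ->
  exists2 x, u <= x <= v & T x = y.
Proof.
move=> /andP[uy yv] uv; have [x Tx] := surjective_lift y.
(* Truncating any preimage to the segment keeps its image, since [y] already lies between [T u] and
   [T v]. *)
exists ((x `|` u) `&` v)%O; first by rewrite lexI leUr uv leIr.
by have [_ TU TI] := Th; rewrite TI TU Tx (join_l uy) (meet_l yv).
Qed.

Lemma surjective_lift_ge0 y : 0 <= y -> exists2 x, 0 <= x & T x = y.
Proof.
move=> y0; have [x Tx] := surjective_lift y; exists (vpos x); first exact: vpos_ge0.
by rewrite lattice_hom_vpos Tx vpos_id.
Qed.

End LatticeHoms.

(** * Order embeddings whose range is an ideal *)

Section OrderEmbeddings.
Context {R : realType} {E F : vectorLatticeType R}.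
Variable T : E -> F.
Hypotheses (Tl : linear T) (Tle : {mono T : x y / x <= y}).
Hypothesis Tideal : forall u w, 0 <= u -> 0 <= w <= T u ->
  exists2 v, 0 <= v <= u & T v = w.

(** Elements between [0] and some [T u] have preimages and [T] reflects the order, so positive parts
    and lower bounds formed in [F] can be pulled back to [E]. *)
Lemma ideal_embedding_NIVL : @NIVL R E F T.
Proof.
have T0 := linear_zero Tl.
have Tpos : positive_operator T by split=> // u u0; rewrite -T0 Tle.
have TV x : T (vpos x) = vpos (T x).
  apply/eqP; rewrite eq_le; apply/andP; split; last first.
    by rewrite leUx Tle leUl Tpos.2 ?vpos_ge0.
  have [||v _ Tv] := @Tideal (vpos x) (vpos (T x)); first exact: vpos_ge0.
    by rewrite vpos_ge0 leUx Tle leUl Tpos.2 ?vpos_ge0.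
  by rewrite -Tv Tle leUx -Tle Tv leUl -Tle Tv T0 vpos_ge0.
have TU : {morph T : x y / (x `|` y)%O}.
  by move=> x y; rewrite !join_vpos (linear_add Tl) TV (linear_sub Tl).
have TI : {morph T : x y / (x `&` y)%O}.
  by move=> x y; rewrite !meet_join_opp !(linear_opp Tl) TU !(linear_opp Tl).
split; first split; first by [].
  move=> D [[d Dd] _ [D0 Dinf]].
  split=> [_ [x Dx <-]|l lD].
    by rewrite vabs_ge0_id Tpos.2 ?D0.
  (* Unlike [l], its positive part is sure to lie in a segment [[0, T d]], hence in the range of
     [T]. *)
  apply: (@le_trans _ _ (vpos l)); first exact: leUl.
  have lT x : D x -> vpos l <= T x.
    move=> Dx; rewrite leUx Tpos.2 ?D0// andbT.
    by apply: lD; exists x; rewrite // vabs_ge0_id// Tpos.2// D0.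
  have [||v _ Tv] := @Tideal d (vpos l); [exact: D0|by rewrite vpos_ge0 lT|].
  by rewrite -Tv -T0 Tle; apply: Dinf => x Dx; rewrite -Tle Tv lT.
split=> // u u0; apply/seteqP; split=> [_ [x /= /andP[x0 xu] <-]|y /= y0u].
  by rewrite -T0 !Tle x0.
by have [x xu <-] := Tideal u0 y0u; exists x.
Qed.

End OrderEmbeddings.

(** * Adjoints of surjective lattice homomorphisms *)

Lemma oc_dual_leP (R : realType) (E : vectorLatticeType R) (f g : oc_dual E) :
  reflect (forall u : E, 0 <= u -> (f : oc_dual_fun E) u <= (g : oc_dual_fun E) u)
    (f <= g).
Proof. exact: asboolP. Qed.

Lemma oc_dual_eq (R : realType) (E : vectorLatticeType R) (f g : oc_dual E) :
  (forall u : E, (f : oc_dual_fun E) u = (g : oc_dual_fun E) u) -> f = g.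
Proof. by move=> fg; apply/val_inj/order_dual_eq => u _; apply: fg. Qed.

Section AdjointOfSurjection.
Context {R : realType} {E F : vectorLatticeType R}.
Variable T : E -> F.
Hypotheses (Th : lattice_hom T) (Tsurj : range T = setT).
Hypotheses (Tp : positive_operator T) (Tc : order_continuous T).

Let Tl : linear T. Proof. by case: Th. Qed.

Lemma oc_adjoint_linear : linear (oc_adjoint Tp Tc).
Proof. by move=> a f g; apply: oc_dual_eq. Qed.

(** Positive elements of [F] have positive preimages, so both inequalities are tested on the same
    values. *)
Lemma oc_adjoint_le : {mono oc_adjoint Tp Tc : f g / f <= g}.
Proof.
move=> f g; apply/oc_dual_leP/oc_dual_leP => fg u u0 /=.
  by have [x x0 <-] := surjective_lift_ge0 Th Tsurj u0; apply: fg.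
exact/fg/Tp.2.
Qed.

Hypothesis Earch : archimedean E.

(* A positive lower bound [l] of the positive preimage [D'] of [D] is killed by
   [T], so [D'] is stable under subtraction of [l]; iterating, all multiples of
   [l] are lower bounds of [D']. *)
Lemma preimage_decreases_to0 (D : set F) :
  decreases_to0 D -> decreases_to0 [set x | 0 <= x /\ D (T x)].
Proof.
move=> [[d Dd] Ddir [D0 Dinf]].
have lift y : D y -> exists2 x, 0 <= x & T x = y.
  by move=> Dy; apply: surjective_lift_ge0 => //; exact: D0.
split.
- by have [x x0 Tx] := lift _ Dd; exists x; split; rewrite ?Tx.
- move=> x y [x0 Dx] [y0 Dy]; have [z [Dz zx zy]] := Ddir _ _ Dx Dy.
  have [w w0 Tw] := lift _ Dz; exists (w `&` (x `&` y))%O.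
  have [_ _ TI] := Th.
  split; last 2 first.
  + by apply: le_trans (leIr _ _) _; exact: leIl.
  + by apply: le_trans (leIr _ _) _; exact: leIr.
  + by split; [rewrite !lexI w0 x0|rewrite !TI Tw (meet_l (y := (_ `&` _)%O))// lexI zx].
- split=> [x []//|l lD].
  apply: (@le_trans _ _ (vpos l)); first exact: leUl.
  have {}lD x : 0 <= x -> D (T x) -> vpos l <= x by move=> x0 Dx; rewrite leUx lD.
  have Tl0 : T (vpos l) = 0.
    apply/eqP; rewrite eq_le Tp.2 ?vpos_ge0// andbT.
    apply: Dinf => y Dy; have [x x0 Tx] := lift _ Dy.
    by rewrite -Tx lattice_hom_mono// lD// Tx.
  have [x x0 Tx] := lift _ Dd.
  apply: (archimedean_le0 Earch x0) => n.
  suff [] : 0 <= x - vpos l *+ n.+1 /\ T (x - vpos l *+ n.+1) = d.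
    by rewrite vsubr_ge0.
  elim: n.+1 => [|k [xk0 Txk]]; first by rewrite subr0.
  rewrite mulrSr opprD addrA vsubr_ge0 lD ?Txk//; split=> //.
  by rewrite linear_sub// Tl0 subr0.
Qed.

(** [psi] evaluates [phi] at any preimage. Lifting segments gives order boundedness, and
    [preimage_decreases_to0] transfers order continuity. *)
Lemma oc_dual_factor (phi : oc_dual E) :
  (forall x, 0 <= x -> T x = 0 -> (phi : oc_dual_fun E) x = 0) ->
  exists psi, oc_adjoint Tp Tc psi = phi.
Proof.
pose phi' := phi : oc_dual_fun E => phi_ker.
have phiB x y : phi' (x - y) = phi' x - phi' y by exact: order_dualB.
(* The hypothesis on positive elements extends to the whole kernel because [T] commutes with
   positive parts. *)
have ker x : T x = 0 -> phi' x = 0.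
  move=> Tx; rewrite -[x]vposB phiB.
  rewrite [phi' (vpos x)]phi_ker ?vpos_ge0 ?lattice_hom_vpos ?Tx ?vpos0//.
  rewrite [phi' _]phi_ker ?vpos_ge0 ?lattice_hom_vpos ?(linear_opp Tl) ?Tx ?oppr0 ?vpos0//.
  exact: addr0.
pose psi y : R^o := phi' (sval (cid (surjective_lift Tsurj y))).
have psiT x : psi (T x) = phi' x.
  rewrite /psi; case: cid => x' /= Tx'; apply/eqP; rewrite -subr_eq0 -phiB ker//.
  by rewrite linear_sub// Tx' subrr.
have psi_dual : psi \in order_dual_pred.
  apply/asboolP; split=> [a y1 y2|a b].
    have [x1 <-] := surjective_lift Tsurj y1.
    have [x2 <-] := surjective_lift Tsurj y2.
    by rewrite -Tl !psiT; apply: order_dual_linear.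
  have [ab|nab] := boolP (a <= b); last first.
    exists 0, 0 => x /andP[ax xb]; case/negP: nab; exact: le_trans xb.
  have [a' Ta'] := surjective_lift Tsurj a.
  (* Lifting [b - a] to a positive [c], rather than lifting [b], puts the upper endpoint [a' + c]
     above [a']. *)
  have [|c c0 Tc'] := @surjective_lift_ge0 _ _ _ _ Th Tsurj (b - a).
    by rewrite vsubr_ge0.
  have [m [M mM]] := order_dual_bounded phi' a' (a' + c).
  exists m, M => y aby.
  have [||x xa <-] := @surjective_lift_segment _ _ _ _ Th Tsurj a' (a' + c) y.
  - by rewrite linear_add// Ta' Tc' addrC subrK.
  - by rewrite -{1}[a']addr0 vlerD2l.
  - by rewrite psiT; apply: mM.
have psi_oc : OrderDualFun psi_dual \in oc_dual_pred (E := F).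
  apply/asboolP/order_continuous_dualP => D /preimage_decreases_to0 D0 eps eps0.
  have /asboolP/order_continuous_dualP phic := oc_dual_valP phi.
  have [x [_ Dx] phix] := phic _ D0 _ eps0.
  by exists (T x) => //=; rewrite psiT.
exists (OcDualFun psi_oc); apply: oc_dual_eq => x /=; exact: psiT.
Qed.

(** A functional between [0] and [f \o T] vanishes at positive elements killed by [T], so it factors
    through [T]; hence the range of the adjoint is an ideal. *)
Lemma oc_adjoint_NIVL : NIVL (oc_adjoint Tp Tc).
Proof.
apply: ideal_embedding_NIVL; [exact: oc_adjoint_linear|exact: oc_adjoint_le|].
move=> f g f0 /andP[/oc_dual_leP g0 /oc_dual_leP gf].
have [x x0 Tx|h hg] := @oc_dual_factor g.
  apply/eqP; rewrite eq_le; apply/andP; split; last exact: g0.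
  apply: le_trans (gf x x0) _.
  rewrite [X in X <= _](_ : _ = (f : oc_dual_fun F) (T x))// Tx.
  by rewrite -(subrr (0 : F)) order_dualB subrr.
exists h => //; rewrite -oc_adjoint_le -(oc_adjoint_le h) hg.
rewrite (linear_zero oc_adjoint_linear); apply/andP; split; exact/oc_dual_leP.
Qed.

End AdjointOfSurjection.

(** * The lattice of compatible families *)

Section CompatibleFamilies.
Variables (R : realType) (I : inverse_diagram R).
Hypothesis hI : is_inverse_system (@VL R) I.

Definition compatible (u : forall n, I n) :=
  forall m n (nm : (n <= m)%N), inv_map nm (u m) = u n.

(** The standard realisation of the inverse limit in [VL], inside the product of the [I n]. *)
Record compatible_family := CompatibleFamily {
  family_val :> forall n, I n;
  family_compat : compatible family_val }.

Lemma compatible_family_ext (u v : compatible_family) : (forall n, u n = v n) -> u = v.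
Proof.
case: u v => [u cu] [v cv] /= uv.
have {}uv : u = v by apply: functional_extensionality_dep.
subst v; by rewrite (Prop_irrelevance cu cv).
Qed.

HB.instance Definition _ := gen_eqMixin compatible_family.
HB.instance Definition _ := gen_choiceMixin compatible_family.

Implicit Types (u v w : compatible_family) (a : R).

Let pl m n (nm : (n <= m)%N) : linear (@inv_map R I m n nm).
Proof. by have [] := hI.1 m n nm. Qed.

Let compat0 : compatible (fun n => 0).
Proof. by move=> m n nm; rewrite linear_zero. Qed.
Let compatD u v : compatible (fun n => u n + v n).
Proof. by move=> m n nm; rewrite linear_add// !family_compat. Qed.
Let compatN u : compatible (fun n => - u n).
Proof. by move=> m n nm; rewrite linear_opp// !family_compat. Qed.
Let compatZ a u : compatible (fun n => a *: u n).
Proof. by move=> m n nm; rewrite linear_scale// !family_compat. Qed.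
Let compatI u v : compatible (fun n => u n `&` v n)%O.
Proof. by move=> m n nm; have [_ _ ->] := hI.1 m n nm; rewrite !family_compat. Qed.
Let compatU u v : compatible (fun n => u n `|` v n)%O.
Proof. by move=> m n nm; have [_ -> _] := hI.1 m n nm; rewrite !family_compat. Qed.

Let zero := CompatibleFamily compat0.
Let add u v := CompatibleFamily (compatD u v).
Let opp u := CompatibleFamily (compatN u).
Let scale a u := CompatibleFamily (compatZ a u).
Let meet u v := CompatibleFamily (compatI u v).
Let join u v := CompatibleFamily (compatU u v).
Let le u v := `[< forall n, u n <= v n >].

Let addA : associative add.
Proof. by move=> u v w; apply: compatible_family_ext => n; apply: addrA. Qed.
Let addC : commutative add.
Proof. by move=> u v; apply: compatible_family_ext => n; apply: addrC. Qed.
Let add0 : left_id zero add.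
Proof. by move=> u; apply: compatible_family_ext => n; apply: add0r. Qed.
Let addN : left_inverse zero opp add.
Proof. by move=> u; apply: compatible_family_ext => n; apply: addNr. Qed.

HB.instance Definition _ := GRing.isZmodule.Build compatible_family addA addC add0 addN.

Let scaleA a b u : scale a (scale b u) = scale (a * b) u.
Proof. by apply: compatible_family_ext => n; apply: scalerA. Qed.
Let scale1 : left_id 1 scale.
Proof. by move=> u; apply: compatible_family_ext => n; apply: scale1r. Qed.
Let scaleDr : right_distributive scale +%R.
Proof. by move=> a u v; apply: compatible_family_ext => n; apply: scalerDr. Qed.
Let scaleDl u : {morph scale^~ u : a b / a + b}.
Proof. by move=> a b; apply: compatible_family_ext => n; apply: scalerDl. Qed.

HB.instance Definition _ :=
  GRing.Zmodule_isLmodule.Build R compatible_family scaleA scale1 scaleDr scaleDl.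

Let le_refl : reflexive le.
Proof. by move=> u; apply/asboolP. Qed.
Let le_anti : antisymmetric le.
Proof.
move=> u v /andP[/asboolP uv /asboolP vu]; apply: compatible_family_ext => n.
by apply/eqP; rewrite eq_le uv vu.
Qed.
Let le_trans : transitive le.
Proof.
by move=> v u w /asboolP uv /asboolP vw; apply/asboolP => n; apply: le_trans (uv n) _.
Qed.
Let meetP u v w : le u (meet v w) = le u v && le u w.
Proof.
apply/asboolP/andP => [h|[/asboolP uv /asboolP uw] n]; last by rewrite lexI uv uw.
by split; apply/asboolP => n; have := h n; rewrite lexI => /andP[].
Qed.
Let joinP u v w : le (join u v) w = le u w && le v w.
Proof.
apply/asboolP/andP => [h|[/asboolP uv /asboolP uw] n]; last by rewrite leUx uv uw.
by split; apply/asboolP => n; have := h n; rewrite leUx => /andP[].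
Qed.
Let leD w u v : le u v -> le (u + w) (v + w).
Proof. by move=> /asboolP uv; apply/asboolP => n; apply: vlerD. Qed.
Let leZ a u : 0 <= a -> le 0 u -> le 0 (a *: u).
Proof. by move=> a0 /asboolP u0; apply/asboolP => n; exact: vlerZ a0 (u0 n). Qed.

Definition family_lattice : vectorLatticeType R :=
  @VectorLattice R compatible_family le meet join
    le_refl le_anti le_trans meetP joinP leD leZ.

Definition family_cone : inverse_cone I :=
  @InverseCone R I family_lattice (fun n (u : compatible_family) => u n).

(** Makes the families a test object for the universal property, through which an abstract limit is
    compared with the concrete one. *)
Lemma family_cone_compatible : is_inverse_compatible (@VL R) family_cone.
Proof. by split=> // m n nm u; apply: (family_compat u). Qed.

End CompatibleFamilies.

(** * The abstract inverse limit and its coordinate maps *)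

Section InverseLimit.
Context {R : realType} {I : inverse_diagram R} {S : inverse_cone I}.
Hypothesis hS : is_inverse_limit (@VL R) S.

Let p n : S -> I n := @cone_map R I S n.

Lemma cone_map_hom n : lattice_hom (p n).
Proof. by have [_ [h _] _] := hS; apply: h. Qed.

Let cone_map_linear n : linear (p n). Proof. by case: (cone_map_hom n). Qed.

Lemma cone_map_compat m n (nm : (n <= m)%N) x : inv_map nm (p m x) = p n x.
Proof. by have [_ [_ h] _] := hS; apply: h. Qed.

Let family_of (x : S) : compatible_family I :=
  CompatibleFamily (fun m n nm => @cone_map_compat m n nm x).

Lemma inverse_limit_lift (u : compatible_family I) : exists x, forall n, p n x = u n.
Proof.
have [hI _ univ] := hS.
have [s [[_ ps] _]] := univ _ (family_cone_compatible hI).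
by exists (s u) => n; apply: ps.
Qed.

(** Both [id] and [s \o family_of] mediate from [S] to itself, so they agree by uniqueness, and [x]
    is recovered from its coordinates. *)
Lemma inverse_limit_inj (x y : S) : (forall n, p n x = p n y) -> x = y.
Proof.
move=> xy; have [hI Scompat univ] := hS.
have [s [[sh ps] _]] := univ _ (family_cone_compatible hI).
have [i [_ iuniq]] := univ _ Scompat.
have famh : lattice_hom (family_of : S -> family_lattice hI).
  split=> [a u v|u v|u v]; apply: compatible_family_ext => n /=.
  - by have [-> _ _] := cone_map_hom n.
  - by have [_ -> _] := cone_map_hom n.
  - by have [_ _ ->] := cone_map_hom n.
have idE : i = id by apply: iuniq; split=> // u.
have sE : i = s \o family_of.
  apply: iuniq; split; last by move=> n u /=; apply: ps.
  case: sh => sl sU sI; case: famh => fl fU fI.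
  by split=> [a u v|u v|u v] /=; rewrite ?fl ?fU ?fI ?sl ?sU ?sI.
have fam z : s (family_of z) = z by rewrite -[RHS]/(id z) -idE sE.
by rewrite -(fam x) -(fam y); congr (s _); apply: compatible_family_ext.
Qed.

Lemma inverse_limit_le (x y : S) : (forall n, p n x <= p n y) -> x <= y.
Proof.
move=> xy; apply/meet_idPl/inverse_limit_inj => n.
by have [_ _ ->] := cone_map_hom n; exact/meet_idPl/xy.
Qed.

Lemma inverse_limit_archimedean : (forall n, archimedean (I n)) -> archimedean S.
Proof.
move=> Iarch u u0; split=> [_ [n _ <-]|l lu].
  by rewrite vlerZ// invr_ge0 ler0n.
apply: inverse_limit_le => n.
have [pl _ _] := cone_map_hom n.
rewrite linear_zero//; apply: (Iarch n (p n u) _).2 => [|_ [k _ <-]].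
  by rewrite -(linear_zero pl) (lattice_hom_mono (cone_map_hom n)).
by rewrite -linear_scale// (lattice_hom_mono (cone_map_hom n))// lu//; exists k.
Qed.

Let hI : is_inverse_system (@VL R) I. Proof. by case: hS. Qed.

Lemma inv_map_comp k m n (nm : (n <= m)%N) (mk : (m <= k)%N) (nk : (n <= k)%N) x :
  @inv_map R I m n nm (inv_map mk x) = inv_map nk x.
Proof. by rewrite (bool_irrelevance nk (leq_trans nm mk)); apply: hI.2. Qed.

Hypothesis p_surj : forall m n (nm : (n <= m)%N), range (@inv_map R I m n nm) = setT.

Lemma inv_map_id n (nn : (n <= n)%N) (x : I n) : inv_map nn x = x.
Proof. by have [y <-] := surjective_lift (p_surj nn) x; apply: inv_map_comp. Qed.

(** Preimages of [y] are chosen recursively, one level at a time, and completed to a compatible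
    family. *)
Lemma cone_map_surjective n : range (p n) = setT.
Proof.
apply/seteqP; split=> // y _.
have lift k (x : I (k + n)%N) : {x' : I (k.+1 + n)%N | inv_map (leqnSn (k + n)) x' = x}.
  exact/cid/surjective_lift/p_surj.
(* [z k] lives at level [k + n]; as [0 + n] computes to [n], [z 0] can be [y] itself. *)
pose z := fix z k : I (k + n)%N := if k is k'.+1 then sval (lift k' (z k')) else y.
have zcompat j k (kj : (k + n <= j + n)%N) : inv_map kj (z j) = z k.
  elim: j kj => [|j IH] kj.
    have k0 : k = 0%N by move: kj; rewrite leq_add2r leqn0 => /eqP.
    by subst k; rewrite inv_map_id.
  have := kj; rewrite leq_add2r leq_eqVlt => /orP[/eqP kj'|].
    by subst k; rewrite inv_map_id.
  rewrite ltnS -(leq_add2r n) => kj'.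
  rewrite -(IH kj') -[in RHS](svalP (lift j (z j))).
  by rewrite (inv_map_comp _ _ kj).
(* Descending from level [m + n] to level [m] defines all coordinates uniformly, including those
   below [n]. *)
have zc : compatible (fun m => inv_map (leq_addr n m) (z m)).
  move=> m k km; have km' : (k + n <= m + n)%N by rewrite leq_add2r.
  by rewrite -(zcompat _ _ km') !(inv_map_comp _ _ (leq_trans km (leq_addr n m))).
have [x px] := inverse_limit_lift (CompatibleFamily zc).
(* Coordinate [n] is the image of [z n] from level [n + n], which [zcompat] identifies with
   [z 0]. *)
exists x => //; rewrite px /= -[RHS](inv_map_id (leqnn n) y).
have n2 : (0 + n <= n + n)%N by rewrite leq_addr.
rewrite -[y in RHS](zcompat n 0%N n2).
by rewrite (inv_map_comp _ n2 (leq_addr n n)).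
Qed.

(* Otherwise there are [u k >= 0] with [p k (u k) = 0] and [`|phi (u k)| = k],
   and all of them lie below [\sum_k u k], whose coordinates are finite sums
   because [p n (u k) = 0] for [n <= k]. *)
Lemma order_dual_ker_cone_map (phi : order_dual_fun S) :
  exists n, forall x, 0 <= x -> p n x = 0 -> phi x = 0.
Proof.
apply: contrapT => noN.
have phiZ (a : R) x : phi (a *: x) = a * phi x.
  have := order_dual_linear phi a x 0; rewrite !addr0 => ->.
  by have := order_dualB phi 0 0; rewrite !subrr => ->; rewrite addr0.
have /choice[u uP] k : exists u : S, [/\ 0 <= u, p k u = 0 & `|phi u| = k%:R].
  apply: contrapT => nou; apply: noN; exists k => x x0 px.
  apply/eqP; apply: contrapT => /negP phix; apply: nou.
  exists ((k%:R / `|phi x|) *: x); have [pl _ _] := cone_map_hom k; split.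
  - by rewrite vlerZ// divr_ge0.
  - by rewrite (linear_scale pl) [p k x]px scaler0.
  - by rewrite phiZ normrM normf_div normr_nat normr_id divfK// normr_eq0.
have pu0 k n : 0 <= p n (u k).
  rewrite -(linear_zero (@cone_map_linear n)) (lattice_hom_mono (cone_map_hom n))//.
  by have [] := uP k.
have pnk k n : (n <= k)%N -> p n (u k) = 0.
  move=> nk; rewrite -(cone_map_compat nk); have [_ -> _] := uP k.
  by rewrite linear_zero//; have [] := hI.1 _ _ nk.
pose w n := \sum_(k < n) p n (u k).
have wc : compatible w.
  move=> m n nm; have [pl _ _] := hI.1 _ _ nm.
  rewrite /w (big_morph _ (linear_add pl) (linear_zero pl)).
  under eq_bigr do rewrite cone_map_compat.
  rewrite -!(big_mkord xpredT (fun k => p n (u k))) (@big_cat_nat _ _ _ n)//=.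
  rewrite [X in _ + X]big1_seq ?addr0// => k /=; rewrite mem_index_iota => /andP[nk _].
  exact: pnk.
have [x px] := inverse_limit_lift (CompatibleFamily wc).
have ux k : 0 <= u k <= x.
  have [-> _ _] := uP k; apply: inverse_limit_le => n; rewrite px /= /w.
  have sum_ge0 (P : pred 'I_n) : 0 <= \sum_(j < n | P j) p n (u j).
    by apply: (big_ind (fun y : I n => 0 <= y)) => // ? ?; exact: vaddr_ge0.
  have [nk|kn] := leqP n k; first by rewrite pnk//; apply: sum_ge0.
  by rewrite (bigD1 (Ordinal kn))//= -{1}[p n (u k)]addr0 vlerD2l sum_ge0.
have /order_boundedP/(_ 0 x)[M phiM] := order_dual_bounded phi.
(* The index is chosen above the absolute value of [M], so [u] there violates the bound. *)
have := phiM _ (ux (Num.bound `|M|)).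
have [_ _ ->] := uP (Num.bound `|M|).
by rewrite leNgt (le_lt_trans (ler_norm M) (archi_boundP (normr_ge0 M))).
Qed.

End InverseLimit.

(** * A criterion for direct limits in [NIVL] *)

Section DirectLimits.
Context {R : realType} {D : direct_diagram R}.

Section Criterion.
Variable G : direct_cocone D.
Hypotheses (hD : is_direct_system (@NIVL R) D) (hG : is_direct_compatible (@NIVL R) G).
Hypothesis e_inj : forall n, injective (@cocone_map R D G n).
Hypothesis e_onto : forall g : G, exists n x, @cocone_map R D G n x = g.

Let e n : D n -> G := @cocone_map R D G n.

Let e_hom n : lattice_hom (@e n). Proof. by have [[]] := hG.1 n. Qed.
Let e_linear n : linear (@e n). Proof. by case: (@e_hom n). Qed.
Let e_le n : {mono @e n : x y / x <= y}.
Proof. exact: lattice_hom_inj_le (@e_hom n) (@e_inj n). Qed.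

Let e_ideal n u w : 0 <= w <= @e n u -> exists2 v, 0 <= v <= u & e v = w.
Proof.
move=> /andP[w0 wu]; have u0 : 0 <= u by rewrite -(@e_le n) linear_zero// (le_trans w0).
have [_ [_ /(_ u u0) eu]] := hG.1 n.
have : [set w | 0 <= w <= e u] w by rewrite /= w0.
by rewrite -eu => -[v /= vu <-]; exists v.
Qed.

Section Mediating.
Variable G' : direct_cocone D.
Hypothesis hG' : is_direct_compatible (@NIVL R) G'.

Let e' n : D n -> G' := @cocone_map R D G' n.

Let mediating_fun : exists r : G -> G', forall n x, r (@e n x) = @e' n x.
Proof.
have /choice[r rP] (g : G) : exists g', exists n x, @e n x = g /\ @e' n x = g'.
  by have [n [x ex]] := e_onto g; exists (e' x), n, x.
exists r => n x; have [m [y [yx <-]]] := rP (e x).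
(* Two representatives of one element become equal at level [maxn m n] by injectivity, so the chosen
   value does not depend on the representative. *)
rewrite /e' -(hG'.2 _ _ (leq_maxl m n) y) -(hG'.2 _ _ (leq_maxr m n) x) /=.
congr cocone_map; apply: e_inj.
by have /= -> := hG.2 _ _ (leq_maxl m n) y; have /= -> := hG.2 _ _ (leq_maxr m n) x.
Qed.

Let common (g h : G) : exists n x y, @e n x = g /\ @e n y = h.
Proof.
have [m [x <-]] := e_onto g; have [n [y <-]] := e_onto h.
exists (maxn m n), (dir_map (leq_maxl m n) x), (dir_map (leq_maxr m n) y).
by split; apply: hG.2.
Qed.

(** Every property is checked at one level: any two elements have representatives in a common [D n],
    and the range of [e n] is an ideal. *)
Lemma mediating_NIVL (r : G -> G') : (forall n x, r (@e n x) = @e' n x) -> NIVL r.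
Proof.
move=> re; have e'_NIVL n : NIVL (@e' n) := hG'.1 n.
have rh : lattice_hom r.
  split=> [a g h|g h|g h]; have [n [x [y [<- <-]]]] := common g h;
    have [el eU eI] := e_hom n; have [[[e'l e'U e'I] _] _] := e'_NIVL n.
  - by rewrite -el !re e'l.
  - by rewrite -eU !re e'U.
  - by rewrite -eI !re e'I.
have rpos := lattice_hom_positive rh.
split; first split=> //.
  move=> A [[d Ad] Adir [A0 Ainf]]; have [n [x ex]] := e_onto d.
  (* The part of [A] below its member [d = e x] is pulled back to [D n], where order continuity of
     [e' n] applies. *)
  pose B := [set y | y <= x /\ A (@e n y)].
  (* Directedness gives [b] in [A] below both [a] and [d]; being below [e x], it is the image of an
     element of [B]. *)
  have below a : A a -> exists2 y, B y & @e n y <= a.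
    move=> Aa; have [b [Ab ba bd]] := Adir _ _ Aa Ad.
    have [|y /andP[y0 yx] ey] := @e_ideal n x b; first by rewrite A0//= /e ex.
    by exists y; [split=> //; rewrite ey|rewrite ey].
  have B_dec : decreases_to0 B.
    split.
    - by exists x; split=> //; rewrite /e ex.
    - move=> y1 y2 [_ Ay1] [_ Ay2]; have [a [Aa a1 a2]] := Adir _ _ Ay1 Ay2.
      have [y By ya] := below _ Aa; exists y; split=> //.
        by rewrite -(@e_le n) (le_trans ya).
      by rewrite -(@e_le n) (le_trans ya).
    - split=> [y [_ Ay]|l lB]; first by rewrite -(@e_le n) linear_zero// A0.
      rewrite -(@e_le n) linear_zero//; apply: Ainf => a Aa.
      by have [y By ya] := below _ Aa; rewrite (le_trans _ ya)// e_le lB.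
  have [[_ e'oc] _] := e'_NIVL n; have [_ Binf] := e'oc _ B_dec.
  split=> [_ [a Aa <-]|l lA].
    by rewrite vabs_ge0_id rpos.2// A0.
  by apply: Binf => _ [y [_ Ay] <-]; rewrite -re; apply: lA; exists (e y).
split=> // g g0; have [n [x ex]] := e_onto g.
have x0 : 0 <= x by rewrite -(@e_le n) linear_zero// /e ex.
have [_ [_ /(_ x x0) e'x]] := e'_NIVL n.
rewrite -ex re -e'x; apply/seteqP; split=> [_ [h /= hx <-]|_ [y /andP[y0 yx] <-]].
  by have [y yx <-] := e_ideal hx; exists y; rewrite ?re.
by exists (e y); rewrite ?re//= -{1}(linear_zero (@e_linear n)) !e_le y0.
Qed.

Lemma mediating_unique :
  exists! r : G -> G', NIVL r /\ forall n, r \o @cocone_map R D G n =1 @cocone_map R D G' n.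
Proof.
have [r re] := mediating_fun; exists r; split.
  by split; [exact: mediating_NIVL|move=> n x; exact: re].
move=> s [_ se]; apply/funext => g; have [n [x <-]] := e_onto g.
by rewrite [LHS]re; apply/esym/se.
Qed.

End Mediating.

Lemma direct_limitP : is_direct_limit (@NIVL R) G.
Proof. by split=> // G' /mediating_unique. Qed.

End Criterion.

End DirectLimits.

(** * Composition in [NIVL] and uniqueness of direct limits *)

Section NIVLCategory.
Context {R : realType}.

Lemma NIVL_id (E : vectorLatticeType R) : NIVL (@id E).
Proof.
apply: ideal_embedding_NIVL => //.
by move=> u w _ w0u; exists w.
Qed.

Lemma NIVL_comp (E F H : vectorLatticeType R) (T : F -> H) (U : E -> F) :
  NIVL T -> NIVL U -> NIVL (T \o U).
Proof.
move=> [[Th Toc] [Tp Tint]] [[Uh Uoc] [Up Uint]].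
have TUh : lattice_hom (T \o U).
  case: Th => Tl TJ TM; case: Uh => Ul UJ UM.
  by split=> [a x y|x y|x y] /=; rewrite ?Ul ?UJ ?UM ?Tl ?TJ ?TM.
split; first split=> // D D0.
  by have := Toc _ (decreases_to0_image Up Uoc D0); rewrite image_comp.
split; first exact: lattice_hom_positive.
by move=> u u0; rewrite -image_comp Uint// Tint// Up.2.
Qed.

(** The mediating morphisms in both directions compose to endomorphisms that, like the identities,
    mediate a limit to itself; uniqueness makes them mutually inverse. *)
Lemma direct_limit_unique (D : direct_diagram R) (G H : direct_cocone D) :
  is_direct_limit (@NIVL R) G -> is_direct_limit (@NIVL R) H ->
  exists r : G -> H, lattice_iso r /\
    forall n, r \o @cocone_map R D G n =1 @cocone_map R D H n.
Proof.
move=> [_ hG univG] [_ hH univH].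
have [r [[rN re] _]] := univG _ hH; have [s [[sN se] _]] := univH _ hG.
have [i [_ iG]] := univG _ hG; have [j [_ jH]] := univH _ hH.
have sr : s \o r = id.
  rewrite -[RHS](iG id); last by split=> //; exact: NIVL_id.
  apply/esym/iG; split; first exact: NIVL_comp.
  by move=> n x /=; have /= -> := re n x; apply: se.
have rs : r \o s = id.
  rewrite -[RHS](jH id); last by split=> //; exact: NIVL_id.
  apply/esym/jH; split; first exact: NIVL_comp.
  by move=> n x /=; have /= -> := se n x; apply: re.
exists r; split=> //; split; first by case: rN => -[].
by exists s => x; [exact: (congr1 (@^~ x) sr)|exact: (congr1 (@^~ x) rs)].
Qed.

End NIVLCategory.

(** * The dual of the inverse limit as a direct limit *)

Section DualOfInverseLimit.
Context {R : realType} {I : inverse_diagram R} {S : inverse_cone I}.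
Hypotheses (hI : is_inverse_system (@NIVL R) I) (hS : is_inverse_limit (@VL R) S).
Hypothesis p_oc : forall n, order_continuous (@cone_map R I S n).
Hypothesis I_arch : forall n, archimedean (I n).
Hypothesis p_surj : forall m n (nm : (n <= m)%N), range (@inv_map R I m n nm) = setT.

Definition dual_cocone : direct_cocone (oc_dual_system hI) :=
  @DirectCocone R (oc_dual_system hI) (oc_dual S)
    (fun n => oc_adjoint (inverse_limit_positive hS n) (@p_oc n)).

Lemma oc_dual_system_direct : is_direct_system (@NIVL R) (oc_dual_system hI).
Proof.
split=> [n m nm|n m k nm mk phi].
  by apply: oc_adjoint_NIVL => //; have [[]] := hI.1 m n nm.
apply: oc_dual_eq => x; congr (oc_dual_val phi _).
exact: (hI.2 k m n nm mk x).
Qed.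

(** The coordinate maps inherit surjectivity from the connecting maps, and [S] inherits the
    Archimedean property from the [I n], so [oc_adjoint_NIVL] applies. *)
Lemma dual_cocone_compatible : is_direct_compatible (@NIVL R) dual_cocone.
Proof.
split=> [n|n m nm phi].
  apply: oc_adjoint_NIVL; [exact: cone_map_hom|exact: cone_map_surjective|].
  exact: inverse_limit_archimedean.
by apply: oc_dual_eq => x; congr (oc_dual_val phi _); apply: cone_map_compat.
Qed.

Lemma dual_cocone_direct_limit : is_direct_limit (@NIVL R) dual_cocone.
Proof.
apply: direct_limitP; [exact: oc_dual_system_direct|exact: dual_cocone_compatible| |].
  (* Injectivity: the adjoint of a surjection reflects the order, so equal images give inequalities
     both ways. *)
  move=> n phi psi /= pp; apply/eqP; rewrite eq_le.
  have ple := oc_adjoint_le (cone_map_hom hS n) (cone_map_surjective hS p_surj n)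
    (inverse_limit_positive hS n) (p_oc n).
  by rewrite -ple -[X in _ && X]ple pp lexx.
(* Joint surjectivity: [phi] vanishes on the positive kernel of some coordinate map, hence factors
   through it. *)
move=> phi; have [n phi_ker] := order_dual_ker_cone_map hS phi.
have [psi <-] := oc_dual_factor (cone_map_hom hS n) (cone_map_surjective hS p_surj n)
  (inverse_limit_positive hS n) (@p_oc n) (inverse_limit_archimedean hS I_arch) phi_ker.
by exists n, psi.
Qed.

End DualOfInverseLimit.

Theorem theorem5p13 (R : realType) (I : inverse_diagram R) (S : inverse_cone I)
  (hI : is_inverse_system (@NIVL R) I)
  (hS : is_inverse_limit (@VL R) S)
  (p_oc : forall n, order_continuous (@cone_map R I S n))
  (I_arch : forall n, archimedean (I n))
  (p_surj : forall m n (nm : (n <= m)%N), range (@inv_map R I m n nm) = setT) :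
  (exists G : direct_cocone (oc_dual_system hI), is_direct_limit (@NIVL R) G) /\
  (forall G : direct_cocone (oc_dual_system hI), is_direct_limit (@NIVL R) G ->
    exists T : G -> oc_dual S,
      lattice_iso T /\
      forall n, T \o @cocone_map R _ G n =1
                oc_adjoint (inverse_limit_positive hS n) (p_oc n)).
Proof.
have lim := dual_cocone_direct_limit hI hS p_oc I_arch p_surj.
(* The dual of [S] witnesses existence, and any limit is isomorphic to it compatibly with the cocone
   maps. *)
by split=> [|G /direct_limit_unique /(_ lim)//]; exists (dual_cocone hI hS p_oc).
Qed.
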